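(* Let $n > 3$ and let $C_n$ be the labeled cycle graph on vertex set $\{1,2,\dots,n\}$ with edges $\{k,k+1\}$ for $1 \le k \le n-1$ together with $\{n,1\}$. Let \[ w_n = 1\, n\, 2\, 1\, 3\, 2\, 4\, 3\, 5\, 4 \cdots (n-1)\,(n-2)\, n\,(n-1), \] i.e. $w_n$ is the word of length $2n$ consisting of the letters $1, n$ followed, for $k = 2, 3, \dots, n$ in turn, by the two letters $k, k-1$. Then there are exactly $4n$ distinct $2$-uniform words $w$ on the alphabet $\{1,\dots,n\}$ with $G(w) = C_n$, and each of them is either a cyclic shift (rotation) of $w_n$ or the reversal (reflection) of a cyclic shift of $w_n$.
   Context: For a word $w$ over an alphabet $\Sigma$ and letters $a,b$, the residual word $w_{a,b}$ is obtained from $w$ by deleting all letters other than $a$ and $b$. Letters $a$ and $b$ occurring in $w$ alternate in $w$ if $w_{a,b}$ contains no two consecutive equal letters. The alternating symbol graph $G(w)$ is the graph with vertex set $\Sigma$ in which $a$ and $b$ are adjacent iff $a$ and $b$ alternate in $w$. A word $w$ represents a graph $G$ if $G(w) = G$. A word is $k$-uniform if every letter of the alphabet occurs in it exactly $k$ times. A rotation (cyclic shift) of $w = x_1 x_2 \cdots x_m$ is a word $x_{i+1} \cdots x_m x_1 \cdots x_i$ for some $0 \le i \le m-1$; a reflection of $w$ is its reversal $x_m x_{m-1} \cdots x_1$. *)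

(* Defs.v *)
From mathcomp Require Import all_boot.

Set Implicit Arguments.
Unset Strict Implicit.
Unset Printing Implicit Defensive.

(* A (labeled, simple) graph with vertex set [T] is a symmetric irreflexive
   [rel T]; two graphs on [T] are equal when their adjacency relations agree. *)

Definition residual (T : finType) (w : seq T) (a b : T) : seq T :=
  [seq x <- w | (x == a) || (x == b)].

Definition alternate (T : finType) (w : seq T) (a b : T) : bool :=
  [&& a \in w, b \in w & sorted (fun x y => x != y) (residual w a b)].

(* [a != b] only matters for letters that occur exactly once in [w]: such a
   letter vacuously alternates with itself, but graphs have no loops. *)
Definition symbol_graph (T : finType) (w : seq T) : rel T :=
  fun a b => (a != b) && alternate w a b.

Definition represents (T : finType) (w : seq T) (G : rel T) : Prop :=
  symbol_graph w =2 G.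

Definition uniform (T : finType) (k : nat) (w : seq T) : Prop :=
  forall a : T, count_mem a w = k.

Definition rotation_of (T : finType) (u v : seq T) : Prop :=
  exists2 i, i < size u & v = rot i u.

Definition reflection_of (T : finType) (u v : seq T) : Prop := v = rev u.

Lemma symbol_graph_sym (T : finType) (w : seq T) : symmetric (symbol_graph w).
Proof.
move=> a b; have res_sym : residual w a b = residual w b a.
  by apply: eq_filter => x; rewrite orbC.
by rewrite /symbol_graph /alternate eq_sym res_sym; congr andb; exact: andbCA.
Qed.

Lemma symbol_graph_irrefl (T : finType) (w : seq T) :
  irreflexive (symbol_graph w).
Proof. by move=> a; rewrite /symbol_graph eqxx. Qed.

(* The alphabet {1, ..., n} is ['I_n], with [i : 'I_n] standing for the letter
   [i.+1].  [ordS] and [ord_pred] are the cyclic successor (n |-> 1) and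
   predecessor (1 |-> n); [cycle_graphE] and [cycle_wordE] give the graph and
   the word in terms of the letters 1, ..., n. *)

Definition cycle_graph (n : nat) : rel 'I_n :=
  fun a b => (b == ordS a) || (a == ordS b).

Definition cycle_word (n : nat) : seq 'I_n :=
  flatten [seq [:: k; ord_pred k] | k <- enum 'I_n].

Lemma cycle_graph_sym (n : nat) : symmetric (@cycle_graph n).
Proof. by move=> a b; rewrite /cycle_graph orbC. Qed.

Lemma cycle_graphE (n : nat) (a b : 'I_n) :
  let k := a.+1 in let l := b.+1 in
  cycle_graph a b =
    [|| l == k.+1, (k == n) && (l == 1), k == l.+1 | (l == n) && (k == 1)].
Proof.
have ordSE (x y : 'I_n) :
    (y == ordS x) = (y.+1 == x.+2) || (x.+1 == n) && (y.+1 == 1).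
  rewrite -val_eqE /= !eqSS; case: (ltngtP x.+1 n) (ltn_ord x) => // [lt|eq] _.
    by rewrite modn_small // orbF.
  by rewrite eq modnn (ltn_eqF (ltn_ord y)).
by rewrite /cycle_graph !ordSE /= -!orbA.
Qed.

Lemma cycle_graph_irrefl (n : nat) : 1 < n -> irreflexive (@cycle_graph n).
Proof.
move=> n_gt1 a; rewrite cycle_graphE /= (ltn_eqF (ltnSn _)) /= orbb.
by apply/negP => /andP[/eqP an /eqP a1]; rewrite -an a1 in n_gt1.
Qed.

Lemma cycle_wordE (n : nat) : 0 < n ->
  [seq (val i).+1 | i <- cycle_word n] =
    [:: 1; n] ++ flatten [seq [:: k; k.-1] | k <- iota 2 n.-1].
Proof.
case: n => // n _; rewrite /cycle_word map_flatten -map_comp.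
have -> : [seq (map (fun i : 'I_n.+1 => (val i).+1) \o
                (fun k => [:: k; ord_pred k])) i | i <- enum 'I_n.+1] =
          [seq [:: k.+1; ((k + n.+1).-1 %% n.+1).+1] | k <- iota 0 n.+1].
  by rewrite -val_enum_ord -map_comp; apply: eq_map => i.
rewrite /= modn_small //; congr [:: _, _ & flatten _].
rewrite (iotaDl 1 1) -map_comp; apply/eq_in_map => k /=.
rewrite mem_iota add1n => /andP[k_gt0 lt_kn].
case: k k_gt0 lt_kn => // k _ lt_kn.
by rewrite addSn /= modnDr modn_small // ltnW.
Qed.

(* Main.v *)
Require Import Defs.
From mathcomp Require Import all_boot.

(* Read a 2-uniform word as a chord diagram on a circle, two letters alternating
   when their chords cross; the represented graph is invariant under rotation
   and reversal.  The letters not adjacent to a letter [a] form a path none of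
   which crosses the chord [a], so they lie on one side of it: the other side
   contains exactly the two neighbours of [a].  Hence up to rotation and
   reversal the word starts with a, a-1, a+1, a.  Applying the same remark to
   the letter a+1 forces the next letters to be a+2, a+1, and so on around the
   cycle, which determines the whole word.  The 4n resulting words are distinct
   because the block "a, two letters, a" occurs at a single place, with its
   middle letters in opposite orders in the word and in its reversal. *)

Set Implicit Arguments.
Unset Strict Implicit.
Unset Printing Implicit Defensive.

(** * Alternation in 2-uniform words, under rotation and reversal *)

Section UniformWords.

Variable T : finType.
Implicit Types (a b c x : T) (u v w : seq T) (i j : nat).

Lemma uniform_perm k u v : perm_eq u v -> uniform k u -> uniform k v.
Proof. by move=> /permP uv ku a; rewrite -uv. Qed.

Lemma uniform_mem w a : uniform 2 w -> a \in w.
Proof. by move=> w2; rewrite -has_pred1 has_count w2. Qed.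

Lemma uniform_alternate w a b : uniform 2 w ->
  alternate w a b = sorted (fun x y => x != y) (residual w a b).
Proof. by move=> w2; rewrite /alternate !uniform_mem. Qed.

Lemma count_residual w a b c : (c == a) || (c == b) ->
  count_mem c (residual w a b) = count_mem c w.
Proof.
by move=> cab; rewrite count_filter; apply: eq_count => x /=; case: eqP => // ->.
Qed.

Lemma residual_notin u a c : a \notin u ->
  residual u a c = nseq (count_mem c u) c.
Proof.
move=> au; have -> : residual u a c = filter (pred1 c) u.
  by apply: eq_in_filter => x xu /=; case: eqP au => // <-; rewrite xu.
by rewrite -size_filter; apply/all_pred1P/filter_all.
Qed.

(** With each letter occurring twice the residual has length four. An alternating word of even
    length has different first and last letters, so it alternates cyclically; the proof checks all
    cases. *)
Lemma sorted_neq_rot1 a b x r : a != b ->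
  all (fun y => (y == a) || (y == b)) (x :: r) ->
  count_mem a (x :: r) = 2 -> count_mem b (x :: r) = 2 ->
  sorted (fun y z => y != z) (rcons r x) = sorted (fun y z => y != z) (x :: r).
Proof.
move=> ab xrab ca cb.
have : size (x :: r) = 4.
  rewrite -(count_predC (pred1 a)) ca (_ : count _ _ = 2) // -cb.
  apply: eq_in_count => y /(allP xrab) /= /orP[] /eqP->; rewrite eqxx ?(negPf ab) //.
  by rewrite eq_sym ab.
have ba : b != a by rewrite eq_sym.
case: r xrab ca cb => [|y [|z [|t [|? ?]]]] //= /and5P[xab yab zab tab _] ca cb _.
by case/orP: xab ca cb => /eqP->; case/orP: yab => /eqP->; case/orP: zab => /eqP->;
   case/orP: tab => /eqP->; rewrite ?eqxx ?(negPf ab) ?(negPf ba).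
Qed.

Lemma symbol_graph_rot w i : uniform 2 w ->
  symbol_graph (rot i w) =2 symbol_graph w.
Proof.
move=> w2 a b; elim: i => [|i IH]; first by rewrite rot0.
case: (ltnP i (size w)) => [iw|wi]; last by rewrite -IH !rot_oversize // leqW.
rewrite -{}IH rotS //.
have: uniform 2 (rot i w) by apply: uniform_perm w2; rewrite perm_sym perm_rot.
case: (rot i w) => [|x t] w2i //; rewrite rot1_cons /symbol_graph.
have w2r: uniform 2 (rcons t x).
  by apply: uniform_perm w2i; rewrite perm_sym perm_rcons.
case: (eqVneq a b) => //= ab; rewrite !uniform_alternate //.
rewrite /residual filter_rcons /=; case: ifP => // xab.
have cnt c : (c == a) || (c == b) -> count_mem c (x :: residual t a b) = 2.
  by move=> /(count_residual (x :: t)); rewrite w2i /residual /= xab.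
apply: (sorted_neq_rot1 ab); rewrite ?cnt ?eqxx ?orbT //=.
by rewrite xab filter_all.
Qed.

Lemma symbol_graph_rev w : symbol_graph (rev w) =2 symbol_graph w.
Proof.
move=> a b; rewrite /symbol_graph /alternate !mem_rev /residual filter_rev.
rewrite rev_sorted; do 3!congr andb; apply: eq_sorted => x y.
by rewrite eq_sym.
Qed.

(** This is the crossing criterion: the chord [a] cuts the circle into the arcs [u] and [v], and
    another chord crosses it exactly when one of its two ends lies in [u]. *)
Lemma symbol_graph_split a u v c : uniform 2 (a :: u ++ a :: v) ->
  symbol_graph (a :: u ++ a :: v) a c = (a != c) && (count_mem c u == 1).
Proof.
move=> w2; rewrite /symbol_graph; case: (eqVneq a c) => //= ac.
rewrite uniform_alternate //.
have /norP[au av] : ~~ ((a \in u) || (a \in v)).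
  rewrite -mem_cat -has_pred1 has_count -leqNgt leqn0.
  by have := w2 a; rewrite /= !count_cat /= eqxx addnCA !add1n !addnS => -[->].
have -> : residual (a :: u ++ a :: v) a c = a :: residual u a c ++ a :: residual v a c.
  by rewrite /residual /= eqxx filter_cat /= eqxx.
rewrite !residual_notin //.
have := w2 c; rewrite /= count_cat /= (negPf ac) !add0n.
have ca : c != a by rewrite eq_sym.
by case: (count_mem c u) => [|[|[|?]]] //; case: (count_mem c v) => [|[|[|?]]] //=;
  rewrite ?ac ?ca ?eqxx.
Qed.

(** * Rotation as a relation between words *)

Lemma rotation_of_trans u v w :
  rotation_of u v -> rotation_of v w -> rotation_of u w.
Proof.
move=> [i iu ->] [j]; rewrite size_rot => ju ->.
rewrite (rot_add_mod (ltnW iu) (ltnW ju)); case: ltngtP => [lt|lt|eq].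
- by exists (j + i).
- by exists (j + i - size u) => //; rewrite (ltn_subLR _ (ltnW lt)) -addnS leq_add // ltnW.
- by exists 0; rewrite ?(leq_ltn_trans _ iu) // eq rot_size rot0.
Qed.

Lemma rotation_of_sym u v : rotation_of u v -> rotation_of v u.
Proof.
move=> [[|i] iu ->]; first by exists 0; rewrite ?rot0.
exists (size u - i.+1); first by rewrite size_rot ltn_subrL (leq_ltn_trans _ iu).
by have := rotK i.+1 u; rewrite /rotr size_rot.
Qed.

Lemma rotation_of_cat u v : 0 < size v -> rotation_of (u ++ v) (v ++ u).
Proof.
by move=> v0; exists (size u); rewrite ?rot_size_cat // size_cat -addn1 leq_add2l.
Qed.

Lemma rotation_of_rev u v : rotation_of u v -> rotation_of (rev u) (rev v).
Proof.
case: u => [|x u] uv; first by case: uv.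
apply: rotation_of_sym; case: uv => i iu ->; exists i.
  by rewrite size_rev size_rot.
by rewrite rev_rot rotrK.
Qed.

Lemma rotation_of_to w a : a \in w -> exists u, rotation_of w (a :: u).
Proof.
move=> aw; case: (rot_to aw) => i u e; exists u.
case: (ltnP i (size w)) => [iw|wi]; first by exists i.
(* An index beyond the size leaves the word unchanged, so 0 serves instead. *)
exists 0; last by rewrite rot0 -e rot_oversize.
by case: (w) aw.
Qed.

End UniformWords.

(** * The cyclic order on the letters *)

Section CycleWords.

Variable n : nat.
Hypothesis n_gt3 : 3 < n.
Implicit Types (a b c x : 'I_n) (u v w r : seq 'I_n) (i j k : nat).

Let n_gt0 : 0 < n. Proof. exact: leq_trans n_gt3. Qed.

Lemma val_iter_ordS a j : iter j (@ordS n) a = (a + j) %% n :> nat.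
Proof.
elim: j => [|j IH]; first by rewrite addn0 modn_small.
by rewrite iterS /= IH -addn1 modnDml addn1 addnS.
Qed.

Lemma iter_ordS_eq a j k : j < n -> k < n ->
  (iter j (@ordS n) a == iter k (@ordS n) a) = (j == k).
Proof.
by move=> jn kn; rewrite -val_eqE /= !val_iter_ordS eqn_modDl !modn_small.
Qed.

Lemma iter_ordS_period a : iter n (@ordS n) a = a.
Proof. by apply: val_inj; rewrite /= val_iter_ordS modnDr modn_small. Qed.

Lemma ord_pred_iter a : ord_pred a = iter n.-1 (@ordS n) a.
Proof. by apply: ordS_inj; rewrite ord_predK -iterS prednK // iter_ordS_period. Qed.

Lemma iter_ordS_onto a b : exists2 j, j < n & b = iter j (@ordS n) a.
Proof.
(* The witness is the distance from [a] to [b] in the direction of [ordS]. *)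
exists ((b + (n - a)) %% n); first by rewrite ltn_mod.
apply: val_inj; rewrite /= val_iter_ordS modnDmr addnCA subnKC ?modnDr ?modn_small //.
exact: ltnW.
Qed.

(** The last inequality would fail for [n = 3], where two steps forward equal one step back. *)
Lemma ordS_neighbours a :
  [/\ ordS a != a, ord_pred a != a, ordS a != ord_pred a
    & ordS (ordS a) != ord_pred a].
Proof.
have lt1 : 1 < n by exact: leq_trans n_gt3.
have lt2 : 2 < n by exact: leq_trans n_gt3.
have ltp : n.-1 < n by rewrite prednK.
have := iter_ordS_eq a; rewrite ord_pred_iter => eqa; split.
- by rewrite (eqa 1 0).
- by rewrite (eqa _ 0) //; case: (n) n_gt3 => [|[]].
- by rewrite (eqa 1) //; case: (n) n_gt3 => [|[|[]]].
- by rewrite (eqa 2) //; case: (n) n_gt3 => [|[|[|[]]]].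
Qed.

Lemma cycle_graphP a b : cycle_graph a b = (b \in [:: ordS a; ord_pred a]).
Proof.
rewrite /cycle_graph !inE; congr orb.
by rewrite -(inj_eq (@ordS_inj n) b) ord_predK eq_sym.
Qed.

Lemma count_neighbours a b :
  count_mem b [:: ordS a; ord_pred a] = cycle_graph a b :> nat.
Proof.
rewrite cycle_graphP count_uniq_mem //= !inE andbT.
by case: (ordS_neighbours a).
Qed.

(** * Words representing the cycle graph: local structure around a letter *)

Definition good w := uniform 2 w /\ represents w (@cycle_graph n).

Lemma good_rotation v w : good v -> rotation_of v w -> good w.
Proof.
move=> [v2 vG] [i _ ->]; split; first by apply: uniform_perm v2; rewrite perm_sym perm_rot.
by move=> a b; rewrite symbol_graph_rot.
Qed.

Lemma good_rev w : good w -> good (rev w).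
Proof.
move=> [w2 wG]; split; first by apply: uniform_perm w2; rewrite perm_sym perm_rev.
by move=> a b; rewrite symbol_graph_rev.
Qed.

Lemma good_split a u v : good (a :: u ++ a :: v) ->
  perm_eq u [:: ordS a; ord_pred a] \/ perm_eq v [:: ordS a; ord_pred a].
Proof.
set w := a :: _ => -[w2 wG].
have adj c : cycle_graph a c = (a != c) && (count_mem c u == 1).
  by rewrite -wG symbol_graph_split.
have cnt c : a != c -> count_mem c u + count_mem c v = 2.
  by move=> ac; rewrite -[RHS](w2 c) /= count_cat /= (negPf ac).
have cnta : (count_mem a u = 0) * (count_mem a v = 0).
  have := w2 a; rewrite /= count_cat /= eqxx addnCA !add1n !addnS => -[/eqP].
  by rewrite addn_eq0 => /andP[/eqP-> /eqP->].
(* A chord that does not cross [a] has both ends in the same arc. *)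
have far c : a != c -> ~~ cycle_graph a c ->
    count_mem c u = 0 /\ count_mem c v = 2 \/ count_mem c u = 2 /\ count_mem c v = 0.
  move=> ac; rewrite adj ac /=; have := cnt c ac.
  by case: (count_mem c u) => [|[|[|]]] //=; case: (count_mem c v) => [|[|[|]]] //=; auto.
have farS j : 1 < j < n.-1 ->
    a != iter j (@ordS n) a /\ ~~ cycle_graph a (iter j (@ordS n) a).
  move=> /andP[j1 jn]; have jn' : j < n by apply: leq_trans jn _; exact: leq_pred.
  have eqj k : k < n -> (iter j (@ordS n) a == iter k (@ordS n) a) = (j == k).
    by move=> kn; apply: iter_ordS_eq.
  rewrite cycle_graphP ord_pred_iter !inE eq_sym (eqj 0) //.
  rewrite (eqj 1 (leq_trans _ n_gt3)) // eqj ?prednK //.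
  by rewrite (gtn_eqF (ltnW j1)) (gtn_eqF j1) (ltn_eqF jn).
have step j : 1 < j -> j.+1 < n.-1 ->
    count_mem (iter j.+1 (@ordS n) a) u = count_mem (iter j (@ordS n) a) u.
  move=> j1 jn; have [ac nac] := farS j (introT andP (conj j1 (ltnW jn))).
  have [ad nad] := farS j.+1 (introT andP (conj (ltnW j1) jn)).
  move: ac nac ad nad; rewrite iterS; move: (iter j _ a) => c ac nac ad nad.
  have /andP[_] : symbol_graph w c (ordS c) by rewrite wG cycle_graphP !inE eqxx.
  rewrite uniform_alternate // /residual /w /= filter_cat /=.
  rewrite (negPf ac) (negPf ad) /= -/(residual u c (ordS c)) -/(residual v c (ordS c)).
  have notin x s : count_mem x s = 0 -> x \notin s by rewrite -has_pred1 has_count => ->.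
  (* If [c] and [ordS c] lay in different arcs, the residual of [u] would be one letter repeated
     twice, although the two letters are adjacent and must alternate. *)
  have [[cu cv]|[cu cv]] := far c ac nac; have [[du dv]|[du dv]] := far _ ad nad;
    rewrite ?cu ?du //.
  - by rewrite (residual_notin _ (notin _ _ cu)) du /= eqxx.
  - rewrite {1}/residual; under eq_filter => x do rewrite orbC.
    by rewrite -/(residual u _ _) (residual_notin _ (notin _ _ du)) cu /= eqxx.
have far2 j : 1 < j < n.-1 ->
    count_mem (iter j (@ordS n) a) u = count_mem (iter 2 (@ordS n) a) u.
  case/andP; elim: j => // j IH; rewrite ltnS leq_eqVlt => /predU1P[<-//|j1] jn.
  by rewrite step // IH // ltnW.
(* This applies to whichever arc is free of the letters at distances 2 to [n - 2] from [a]. *)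
have side s :
  (forall c, cycle_graph a c -> count_mem c s = 1) -> count_mem a s = 0 ->
  (forall j, 1 < j < n.-1 -> count_mem (iter j (@ordS n) a) s = 0) ->
  perm_eq s [:: ordS a; ord_pred a].
  move=> s1 sa s0; apply/allP => c _; apply/eqP; rewrite count_neighbours.
  case gac: (cycle_graph a c); first exact: s1.
  have [[|[|j]] jn ec] := iter_ordS_onto a c; first by rewrite ec.
    by move: gac; rewrite ec cycle_graphP !inE eqxx.
  rewrite ec s0 //= -ltnS prednK // ltn_neqAle jn andbT.
  apply: contraFN gac => /eqP e; rewrite ec cycle_graphP ord_pred_iter !inE.
  have <- : j.+2 = n.-1 by rewrite -e.
  by rewrite eqxx orbT.
have n2 : 1 < 2 < n.-1 by rewrite ltn_predRL.
have nb c : cycle_graph a c -> count_mem c u = 1 /\ count_mem c v = 1.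
  rewrite adj => /andP[ac /eqP cu]; split=> //.
  by have := cnt c ac; rewrite cu add1n => -[].
have [ac nac] := farS 2 n2; have [[cu _]|[cu _]] := far _ ac nac; [left|right].
  apply: side => [c /nb[]|| j /far2 ->] //; first by rewrite cnta.
apply: side => [c /nb[]|| j j2] //; first by rewrite cnta.
by have := cnt _ (farS j j2).1; rewrite far2 // cu; case: count.
Qed.

(** After rotation by two, [good_split] applies to the chord [ordS a]. If its short arc is the one
    opening with [a], that arc has just one more letter, the other neighbour [ordS (ordS a)]. *)
Lemma good_step a r : good [:: a, ord_pred a, ordS a, a & r] ->
  exists r', rot 2 [:: a, ord_pred a, ordS a, a & r] =
    [:: ordS a, a, ordS (ordS a), ordS a & r'].
Proof.
move=> gw; have [w2 _] := gw.
have [Sa Pa SP SSP] := ordS_neighbours a.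
have br : ordS a \in r.
  rewrite -has_pred1 has_count.
  by have := w2 (ordS a); rewrite /= eqxx !(eq_sym _ (ordS a))
    (negPf Sa) (negPf SP) !add0n add1n => -[->].
case/splitPr: br gw w2 => r1 r2 gw w2.
have : good (ordS a :: (a :: r1) ++ ordS a :: r2 ++ [:: a; ord_pred a]).
  apply: good_rotation gw _.
  have := @rotation_of_cat _ [:: a; ord_pred a] [:: ordS a, a & r1 ++ ordS a :: r2] isT.
  by rewrite /= -catA.
move=> /good_split; rewrite ordSK => -[|].
  move=> e; have := perm_size e; case: r1 e {gw w2} => [|x [|]] // e _.
  move: e; rewrite perm_sym (perm_catC [:: _] [:: _]) perm_cons.
  move=> /perm_mem/(_ (ordS (ordS a))).
  rewrite !inE eqxx => /esym/eqP <-.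
  by exists (r2 ++ [:: a; ord_pred a]).
(* The opposite arc cannot be the short one: it contains [ord_pred a], which is not a neighbour of
   [ordS a]. *)
move=> e; have := perm_mem e (ord_pred a).
rewrite mem_cat !inE eqxx !orbT (negPf Pa) orbF.
by rewrite eq_sym (negPf SSP).
Qed.

(** * The word of the theorem, read from an arbitrary starting letter *)

Definition walk a j := flatten [seq [:: x; ord_pred x] | x <- traject (@ordS n) a j].

Lemma size_walk a j : size (walk a j) = j.*2.
Proof. by rewrite /walk; elim: j a => //= j IH a; rewrite IH. Qed.

Lemma walkD a j k : walk a (j + k) = walk a j ++ walk (iter j (@ordS n) a) k.
Proof. by rewrite /walk trajectD map_cat flatten_cat. Qed.

Lemma walk_start a : exists r, walk a n = [:: a, ord_pred a, ordS a, a & r].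
Proof.
have <- : walk a (2 + (n - 2)) = walk a n by rewrite subnKC // ltnW // ltnW.
rewrite walkD /walk /= ordSK.
by eexists.
Qed.

Lemma cycle_word_walk a : val a = 0 -> cycle_word n = walk a n.
Proof.
move=> a0; rewrite /cycle_word /walk; congr (flatten (map _ _)).
apply: (inj_map val_inj); rewrite val_enum_ord.
apply: (@eq_from_nth _ 0) => [|i]; rewrite size_iota ?size_map ?size_traject // => lt_in.
rewrite nth_iota // (nth_map a) ?size_traject // nth_traject //= val_iter_ordS.
by rewrite [nat_of_ord a]a0 modn_small.
Qed.

Lemma rotation_walk a b : rotation_of (walk a n) (walk b n).
Proof.
have [j jn ->] := iter_ordS_onto a b.
have <- : walk a (j + (n - j)) = walk a n by rewrite subnKC // ltnW.
set b' := iter j _ a.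
have <- : walk b' ((n - j) + j) = walk b' n by rewrite subnK // ltnW.
rewrite !walkD -iterD subnK 1?ltnW // iter_ordS_period; apply: rotation_of_cat.
by rewrite size_walk double_gt0 subn_gt0.
Qed.

Lemma uniform_walk a : uniform 2 (walk a n).
Proof.
have uniqT : uniq (traject (@ordS n) a n).
  apply/(uniqP a) => i j; rewrite !inE size_traject => ilt jlt.
  by rewrite !nth_traject // => /eqP; rewrite iter_ordS_eq // => /eqP.
have cntT c : count_mem c (traject (@ordS n) a n) = 1.
  rewrite count_uniq_mem //; have [j jn ->] := iter_ordS_onto a c.
  by apply/eqP; rewrite eqb1; apply/trajectP; exists j.
(* One occurrence of [c] opens its own block, the other closes the block of [ordS c]. *)
move=> c; rewrite -[2]/(1 + 1) -{1}(cntT c) -(cntT (ordS c)) /walk.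
elim: (traject _ _ _) => //= x s ->.
by rewrite -(inj_eq (@ordS_inj n) (ord_pred x)) ord_predK addnACA addnA.
Qed.

(** All walks of length [n] are rotations of one another, so the neighbours of [b] can be read off
    the opening block of the walk that starts at [b]. *)
Lemma good_walk a : good (walk a n).
Proof.
have w2 b : uniform 2 (walk b n) := uniform_walk b.
split=> // b c; have [i _ e] := rotation_walk a b.
rewrite -(symbol_graph_rot i (w2 a)) -e; have [r er] := walk_start b.
have := w2 b; rewrite er => /(@symbol_graph_split _ b [:: ord_pred b; ordS b] r c) ->.
have [Sb Pb _ _] := ordS_neighbours b.
have -> : count_mem c [:: ord_pred b; ordS b] = count_mem c [:: ordS b; ord_pred b].
  by rewrite /= addnCA.
rewrite count_neighbours eqb1 cycle_graphP andb_idl //.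
by rewrite !inE => /orP[] /eqP->; rewrite eq_sym.
Qed.

(** Iterating [good_step] shows the four-letter pattern at every even offset; the first two letters
    of each pattern, put together, spell the walk. *)
Lemma good_walk_prefix a r : good [:: a, ord_pred a, ordS a, a & r] ->
  [:: a, ord_pred a, ordS a, a & r] = walk a n.
Proof.
set w := _ :: _ => gw.
have szw : size w = n.*2.
  rewrite -(size_walk a); apply/perm_size/allP => x _; apply/eqP.
  by rewrite [RHS]uniform_walk; apply: gw.1.
have shape j : j <= n -> exists r', let b := iter j (@ordS n) a in
    rot j.*2 w = [:: b, ord_pred b, ordS b, b & r'].
  elim: j => [|j IH] jn; first by exists r; rewrite rot0.
  have [r' e] := IH (ltnW jn).
  have gj : good (rot j.*2 w).
    by apply: good_rotation gw _; exists j.*2; rewrite // szw ltn_double.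
  rewrite e in gj; have [r'' e''] := good_step gj.
  exists r''; rewrite /= ordSK -e'' -e -rotD //.
  by rewrite szw (leq_double j.+1).
have pref j : j <= n -> take j.*2 w = walk a j.
  elim: j => [|j IH] jn; first by rewrite take0.
  have [r' e] := shape j (ltnW jn).
  rewrite -addn1 walkD -IH ?(ltnW jn) // doubleD takeD; congr (_ ++ _).
  have -> : take 2 (drop j.*2 w) = take 2 (rot j.*2 w).
    by rewrite /rot takel_cat // size_drop szw -doubleB (leq_double 1) subn_gt0.
  by rewrite e.
by rewrite -pref // -szw take_size.
Qed.

Lemma good_rotation_walk a w : good w ->
  rotation_of (walk a n) w \/ exists2 v, rotation_of (walk a n) v & w = rev v.
Proof.
move=> gw; have [t wt] := rotation_of_to (uniform_mem a gw.1).
have gt := good_rotation gw wt.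
have at' : a \in t.
  by rewrite -has_pred1 has_count; have := gt.1 a; rewrite /= eqxx add1n => -[->].
case/splitPr: at' wt gt => u v wt gt.
(* Rotating to the other occurrence of [a] exchanges the arcs, so the short one may be taken
   first. *)
have {t u v wt gt} [u [v [wuv guv pu]]] : exists u v, [/\ rotation_of w (a :: u ++ a :: v),
    good (a :: u ++ a :: v) & perm_eq u [:: ordS a; ord_pred a]].
  case: (good_split gt) => p; [by exists u, v | exists v, u].
  have vu : rotation_of (a :: u ++ a :: v) (a :: v ++ a :: u).
    exact: (@rotation_of_cat _ (a :: u) (a :: v)).
  by split=> //; [exact: rotation_of_trans wt vu | exact: good_rotation gt vu].
case: u wuv guv pu => [|x [|y [|? ?]]] wuv guv pu; try by have := perm_size pu.
have pu' : perm_eq [:: x; y] [:: ord_pred a; ordS a].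
  by apply: perm_trans pu _; apply/permP => f; rewrite /= addnCA.
have: x \in [:: ordS a; ord_pred a] by rewrite -(perm_mem pu) mem_head.
rewrite !inE => /orP[] /eqP ex; subst x.
  (* Here [ordS a] precedes [ord_pred a]; reversal restores the order found in a walk. *)
  right; exists (rev w); last by rewrite revK.
  move: pu; rewrite perm_cons => /(@perm_small_eq _ [:: y] [:: ord_pred a] isT) [ey]; subst y.
  have rot_rev : rotation_of (rev [:: a, ordS a, ord_pred a, a & v])
                             [:: a, ord_pred a, ordS a, a & rev v].
    have := @rotation_of_cat _ (rev v) [:: a; ord_pred a; ordS a; a] isT.
    by rewrite -[X in _ ++ X]/(rev [:: a; ordS a; ord_pred a; a]) -rev_cat.
  rewrite -(good_walk_prefix (good_rotation (good_rev guv) rot_rev)).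
  by apply/rotation_of_sym/(rotation_of_trans _ rot_rev)/rotation_of_rev.
left; move: pu'; rewrite perm_cons => /(@perm_small_eq _ [:: y] [:: ordS a] isT) [ey]; subst y.
by rewrite -(good_walk_prefix guv); apply: rotation_of_sym.
Qed.

(* The letter [a] sits at positions 0 and 3 of [walk a n] only, so a nontrivial
   rotation cannot put it back at both. *)
Lemma rot_walk_eq0 a i : i < n.*2 ->
  nth a (rot i (walk a n)) 0 = a -> nth a (rot i (walk a n)) 3 = a -> i = 0.
Proof.
have [Sa Pa _ _] := ordS_neighbours a; have [r er] := walk_start a.
have sr : size r = n.*2 - 4 by rewrite -(size_walk a) er /= !subSS subn0.
have ar : a \notin r.
  rewrite -has_pred1 has_count; have := uniform_walk a a.
  by rewrite er /= eqxx (negPf Sa) (negPf Pa) !add0n !add1n => -[->].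
rewrite er; case: i => [|[|[|[|i]]]] //= lt_i.
- by move=> e; case/eqP: Pa.
- by move=> e; case/eqP: Sa.
(* A shift by three does put an [a] at position 0; position 3 then holds the third letter of [r],
   which differs from [a]. *)
- have : 3 < size r.
    by rewrite sr ltn_subRL (leq_double 4).
  case: (r) ar => [|x [|y [|z r']]] //= ar _ _ e.
  by rewrite -e !inE eqxx !orbT in ar.
- have ir : i < size r by rewrite sr ltn_subRL.
  rewrite /rot /= (drop_nth a ir) /= => e.
  by rewrite -e mem_nth in ar.
Qed.

Lemma rot_walk_inj a i j : i < n.*2 -> j < n.*2 ->
  rot i (walk a n) = rot j (walk a n) -> i = j.
Proof.
wlog le_ij : i j / i <= j.
  by move=> H iw jw e; case: (leqP i j) => [|/ltnW] ij; [|symmetry]; apply: H.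
move=> iw jw; have -> : rot j (walk a n) = rot i (rot (j - i) (walk a n)).
  by rewrite -rotD subnKC // size_walk ltnW.
move=> /rot_inj e; have [r er] := walk_start a.
have := @rot_walk_eq0 a (j - i); rewrite -e er => /(_ _ erefl erefl) ji.
by apply/eqP; rewrite eqn_leq le_ij /= -subn_eq0 ji // (leq_ltn_trans (leq_subr _ _)).
Qed.

(** Otherwise the walk would have a rotation opening with [a], [ordS a], [ord_pred a], [a]. Its
    shift must be 0, and the second letters then disagree. *)
Lemma rot_walk_neq_rev a i j : i < n.*2 -> j < n.*2 ->
  rot i (walk a n) <> rev (rot j (walk a n)).
Proof.
move=> iw jw e; have [r er] := walk_start a.
have [d] : rotation_of (walk a n) [:: a, ordS a, ord_pred a, a & rev r].
  apply: (@rotation_of_trans _ _ (rev (rot j (walk a n)))).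
    by exists i; rewrite ?size_walk.
  apply: (@rotation_of_trans _ _ (rev (walk a n))).
    by apply/rotation_of_rev/rotation_of_sym; exists j; rewrite ?size_walk.
  have := @rotation_of_cat _ (rev r) [:: a; ordS a; ord_pred a; a] isT.
  by rewrite -[X in _ ++ X]/(rev [:: a; ord_pred a; ordS a; a]) -rev_cat er.
rewrite size_walk => dn ed; have := @rot_walk_eq0 a d dn; rewrite -ed => /(_ erefl erefl) d0.
move: ed; rewrite d0 rot0 er => /(congr1 (nth a ^~ 1)) eSP.
by have [_ _ /eqP/(_ eSP)] := ordS_neighbours a.
Qed.

End CycleWords.

Theorem theorem1 (n : nat) (hn : 3 < n) :
  (exists s : seq (seq 'I_n),
     [/\ uniq s, size s = 4 * n
       & forall w : seq 'I_n,
           w \in s <-> uniform 2 w /\ represents w (@cycle_graph n)]) /\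
  (forall w : seq 'I_n,
     uniform 2 w -> represents w (@cycle_graph n) ->
     rotation_of (cycle_word n) w \/
     (exists2 v, rotation_of (cycle_word n) v & reflection_of v w)).
Proof.
pose a := Ordinal (leq_trans (isT : 0 < 4) hn).
rewrite (@cycle_word_walk n a erefl).
split; last by move=> w w2 wG; apply: good_rotation_walk.
pose rots := [seq rot i (walk a n) | i <- iota 0 n.*2].
have rotsP w : reflect (rotation_of (walk a n) w) (w \in rots).
  apply: (iffP mapP) => -[i]; rewrite ?mem_iota ?size_walk => iw ->; exists i => //.
    by rewrite size_walk.
  by rewrite mem_iota.
have uniq_rots : uniq rots.
  rewrite map_inj_in_uniq ?iota_uniq // => i j; rewrite !mem_iota.
  exact: rot_walk_inj.
(* The [2n] rotations and their [2n] reversals are pairwise distinct. *)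
exists (rots ++ map rev rots); split.
- rewrite cat_uniq uniq_rots (map_inj_uniq (can_inj revK)) uniq_rots andbT /=.
  apply/hasPn => w /mapP[v /mapP[j + ->] ->]; rewrite mem_iota => jw.
  apply/mapP => -[i]; rewrite mem_iota => iw /esym.
  exact: rot_walk_neq_rev.
- by rewrite size_cat !size_map size_iota addnn -!muln2 -mulnA mulnC.
- move=> w; rewrite mem_cat; split=> [/orP[/rotsP rw | /mapP[v /rotsP rv ->]] | gw].
  + exact: good_rotation (good_walk hn a) rw.
  + exact/good_rev/(good_rotation (good_walk hn a) rv).
  + case: (good_rotation_walk hn a gw) => [/rotsP -> // | [v /rotsP rv ->]].
    by rewrite map_f ?orbT.
Qed.
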